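(* Let $n\ge 2$ be an integer and let $A$ be $n$-good. If $1\notin A$ and $n-2\notin A$, then $\dim_H(U_A)\ge \log(2)/\log(n)>0$.
   Context: For an integer $n\ge 2$ and a set $A$ of integers with $0,n-1\in A\subset\{0,1,\dots,n-1\}$, $C_A=C_{A,n}=\left\{\sum_{i=1}^\infty a_i n^{-i} : a_i\in A\right\}$, which is the attractor of the iterated function system $\{x\mapsto (x+a)/n : a\in A\}$. The sign $+$ between sets denotes the Minkowski sum. The set $A$ is called $n$-good if $0,n-1\in A\subset\{0,1,\dots,n-1\}$ and $C_A+C_A=[0,2]$. $U_A$ (the set of uniqueness) is the set of $z\in C_A+C_A$ for which there is exactly one ordered pair $(x,y)\in C_A\times C_A$ with $z=x+y$. $\dim_H$ denotes Hausdorff dimension. *)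

(* Defs.v *)
From mathcomp Require Import all_boot all_order all_algebra.
From mathcomp Require Import all_classical all_reals all_analysis.

Set Implicit Arguments.
Unset Strict Implicit.
Unset Printing Implicit Defensive.

Import Order.TTheory GRing.Theory Num.Theory.
Import numFieldNormedType.Exports.

Local Open Scope classical_set_scope.
Local Open Scope ring_scope.

(* [ereal_sup set0 = -oo], so the diameter of the empty set is -oo. *)
Definition diameter (R : realType) (E : set R) : \bar R :=
  ereal_sup [set `|x - y|%:E | x in E & y in E].

(* |E|^s with the conventions |set0|^s = 0 for all s >= 0 (including s = 0),
   and |E|^0 = 1 for nonempty E, so that H^0 is the counting measure. *)
Definition diameter_pow (R : realType) (s : R) (E : set R) : \bar R :=
  if E == set0 then 0%E else poweR (diameter E) s.

Definition delta_cover (R : realType) (delta : R) (E : set R)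
    (U : nat -> set R) : Prop :=
  E `<=` \bigcup_i U i /\ forall i, (diameter (U i) <= delta%:E)%E.

Definition hausdorff_premeasure (R : realType) (s delta : R) (E : set R)
    : \bar R :=
  ereal_inf [set (\sum_(0 <= i <oo) diameter_pow s (U i))%E
            | U in delta_cover delta E].

(* The premeasure is nonincreasing in delta, so the limit as delta tends to 0
   from the right is the supremum over delta > 0. *)
Definition hausdorff_measure (R : realType) (s : R) (E : set R) : \bar R :=
  ereal_sup [set hausdorff_premeasure s delta E | delta in [set d : R | 0 < d]].

Definition hausdorff_dim (R : realType) (E : set R) : \bar R :=
  ereal_inf [set s%:E | s in [set s : R | 0 <= s /\ hausdorff_measure s E = 0%E]].

Definition minkowski_sum (R : realType) (E F : set R) : set R :=
  [set x + y | x in E & y in F].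

(* Digits are indexed from 0, hence the exponent i.+1. *)
Definition C_set (R : realType) (n : nat) (A : set int) : set R :=
  [set x | exists a : nat -> int, (forall i, A (a i)) /\
     series (fun i => (a i)%:~R / n%:R ^+ i.+1 : R) @ \oo --> x].
Arguments C_set R n A : clear implicits.

Definition n_good (R : realType) (n : nat) (A : set int) : Prop :=
  [/\ A 0, A (n%:Z - 1), A `<=` [set a : int | 0 <= a <= n%:Z - 1] &
      minkowski_sum (C_set R n A) (C_set R n A) = `[0, 2]%classic].
Arguments n_good R n A : clear implicits.

Definition uniqueness_set (R : realType) (n : nat) (A : set int) : set R :=
  [set z | minkowski_sum (C_set R n A) (C_set R n A) z /\
     exists! p : R * R, [/\ C_set R n A p.1, C_set R n A p.2 & z = p.1 + p.2]].
Arguments uniqueness_set R n A : clear implicits.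

(* Main.v *)
Require Import Defs.
From mathcomp Require Import all_boot all_order all_algebra.
From mathcomp Require Import all_classical all_reals all_analysis.
From mathcomp Require Import zify ring lra.

(** Why the theorem holds.  The digit sums of two elements of [A] avoid 1 and
    [2n - 3], because 1 and [n - 2] are missing from [A].  The extreme sums 0
    and [2n - 2] are therefore at distance at least 2 from every other digit
    sum, while 2 units at one position are worth exactly an infinite tail of
    digits [2n - 2].  Hence an expansion in base [n] that uses only the digits
    0 and [2n - 2], each of them infinitely often, is the only one its value
    has with digits in [A + A] ([extreme_digits_unique]).  Moreover 0 and
    [2n - 2] split in one way as a sum of two elements of [A], so the value
    has a unique decomposition in [C_A + C_A].  If [x] has base-[n] digits in
    [{0, n - 1}], not eventually constant, then [2x] lies in [U_A]
    ([double_cantor_point_unique]).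

    The points [2x] form a Cantor set without a countable part.  Copy the bits
    of an irrational [t] in [[0, 1]] to the digits of [x]: irrationality says
    that the bits are not eventually constant.  The map [t |-> 2x] has an
    inverse that is Hoelder with exponent [ln 2 / ln n]
    ([cantor_point_holder]): if the first different bit of [t] and [t'] is at
    position [k], then [t] and [t'] are within [2^-k], whereas their images
    are at least [n^-(k+1)] apart, and [n] to the power [ln 2 / ln n] is 2.  A
    cover of [U_A] with a small sum of diameters to a power [s] below
    [ln 2 / ln n] would thus give a cover of the irrationals of [[0, 1]] by
    intervals of small total length, against the fact that they have positive
    Lebesgue measure ([hausdorff_dim_ge_holder]). *)

Set Implicit Arguments.
Unset Strict Implicit.
Unset Printing Implicit Defensive.

Import Order.TTheory GRing.Theory Num.Theory.
Import numFieldNormedType.Exports.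

Local Open Scope classical_set_scope.
Local Open Scope ring_scope.

(** * Expansions in a real base *)

Definition radix_series (R : realType) (q : R) (u : nat -> R) : nat -> R :=
  series (fun i => u i / q ^+ i.+1).

Lemma radix_seriesS (R : realType) (q : R) (u : nat -> R) m :
  radix_series q u m.+1 = radix_series q u m + u m / q ^+ m.+1.
Proof. by rewrite /radix_series /series /= big_nat_recr. Qed.

Lemma radix_seriesB (R : realType) (q : R) (u v : nat -> R) m :
  radix_series q (fun i => u i - v i) m
  = radix_series q u m - radix_series q v m.
Proof.
elim: m => [|m IHm]; first by rewrite /radix_series /series /= !big_nil subr0.
by rewrite !radix_seriesS IHm mulrBl; ring.
Qed.

Lemma radix_seriesB_cvg (R : realType) (q l l' : R) (u v : nat -> R) :
    radix_series q u @ \oo --> l -> radix_series q v @ \oo --> l' ->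
  radix_series q (fun i => u i - v i) @ \oo --> l - l'.
Proof.
move=> ul vl.
rewrite (_ : radix_series _ _ = radix_series q u \- radix_series q v).
  exact: cvgB.
by apply/funext => m; rewrite radix_seriesB.
Qed.

Lemma radix_seriesD (R : realType) (q : R) (u v : nat -> R) m :
  radix_series q (fun i => u i + v i) m
  = radix_series q u m + radix_series q v m.
Proof.
elim: m => [|m IHm]; first by rewrite /radix_series /series /= !big_nil addr0.
by rewrite !radix_seriesS IHm mulrDl; ring.
Qed.

Lemma radix_seriesZ (R : realType) (q c : R) (u : nat -> R) m :
  radix_series q (fun i => c * u i) m = c * radix_series q u m.
Proof.
elim: m => [|m IHm]; first by rewrite /radix_series /series /= !big_nil mulr0.
by rewrite !radix_seriesS IHm; ring.
Qed.

(** The sum of the digits [c * (q - 1)] at all positions from [m] on is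
    [c / q ^+ m].  When the digits stay below [c * (q - 1)], the partial sum
    plus this tail decreases to the value of the series, so every stage bounds
    the value from above; one step loses exactly the unspent part of the digit
    at that position. *)
Lemma radix_envelope_step (R : realType) (q c : R) (u : nat -> R) m :
    0 < q ->
  radix_series q u m.+1 + c / q ^+ m.+1
  = radix_series q u m + c / q ^+ m - (c * (q - 1) - u m) / q ^+ m.+1.
Proof.
move=> q0; rewrite radix_seriesS exprS.
have qm0 : q ^+ m != 0 by rewrite expf_neq0 ?gt_eqF.
by field; rewrite qm0 gt_eqF.
Qed.

Lemma radix_envelope_le (R : realType) (q c : R) (u : nat -> R) m j :
    0 < q -> (forall i, (m <= i)%N -> u i <= c * (q - 1)) -> (m <= j)%N ->
  radix_series q u j + c / q ^+ j <= radix_series q u m + c / q ^+ m.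
Proof.
move=> q0 uc; elim: j => [|j IHj]; first by rewrite leqn0 => /eqP ->.
rewrite leq_eqVlt => /orP[/eqP -> //|]; rewrite ltnS => mj.
apply: le_trans (IHj mj); rewrite radix_envelope_step // gerBl.
by rewrite divr_ge0 ?exprn_ge0 ?(ltW q0) // subr_ge0 uc.
Qed.

Lemma cvg_div_expr (R : realType) (q c : R) :
  1 < q -> (fun m => c / q ^+ m) @ \oo --> (0 : R).
Proof.
move=> q1; have q0 : 0 < q by apply: lt_trans q1.
rewrite [X in X @ \oo --> _](_ : _ = geometric c q^-1).
  by apply: cvg_geometric; rewrite ger0_norm ?invr_ge0 ?(ltW q0) ?invf_lt1.
by apply/funext => m; rewrite /= exprVn.
Qed.

Lemma radix_lim_le (R : realType) (q c l : R) (u : nat -> R) m :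
    1 < q -> (forall i, (m <= i)%N -> u i <= c * (q - 1)) ->
    radix_series q u @ \oo --> l ->
  l <= radix_series q u m + c / q ^+ m.
Proof.
move=> q1 uc ul; have q0 : 0 < q by apply: lt_trans q1.
have : (fun j => radix_series q u j + c / q ^+ j) @ \oo --> l.
  by rewrite -[l]addr0; apply: cvgD => //; exact: cvg_div_expr.
move/cvgr_to_le; apply; near=> j.
by apply: radix_envelope_le => //; near: j; exact: nbhs_infty_ge.
Unshelve. all: by end_near. Qed.

Lemma radix_series_cvg (R : realType) (q c : R) (u : nat -> R) :
    1 < q -> (forall i, 0 <= u i <= c) -> cvgn (radix_series q u).
Proof.
move=> q1 uc; have q0 : 0 < q by apply: lt_trans q1.
apply: nondecreasing_is_cvgn.
  apply/nondecreasing_seqP => m; rewrite radix_seriesS lerDl.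
  by rewrite divr_ge0 ?exprn_ge0 ?(ltW q0) //; case/andP: (uc m).
have c0 : 0 <= c by case/andP: (uc 0%N) => /le_trans h /h.
exists (c / (q - 1)) => _ [m _ <-].
have uc' i : (0 <= i)%N -> u i <= c / (q - 1) * (q - 1).
  by move=> _; rewrite divfK ?subr_eq0 ?gt_eqF //; case/andP: (uc i).
have := radix_envelope_le q0 uc' (leq0n m).
rewrite /radix_series {2}/series /= big_nil add0r expr0 divr1.
apply: le_trans; rewrite lerDl divr_ge0 ?exprn_ge0 ?(ltW q0) //.
by rewrite divr_ge0 // subr_ge0 ltW.
Qed.

Lemma radix_series_head (R : realType) (q : R) (u : nat -> R) k :
    (forall i, (i < k)%N -> u i = 0) ->
  radix_series q u k.+1 = u k / q ^+ k.+1.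
Proof.
move=> u0; rewrite radix_seriesS [X in X + _](_ : _ = 0) ?add0r //.
by rewrite /radix_series /series /= big_nat big1 // => i /u0 ->; rewrite mul0r.
Qed.

(** A gap [g] at the first different digit outweighs all later digits as
    soon as these lose at most [c] units of that position. *)
Lemma radix_gap (R : realType) (q g c l l' : R) (u v : nat -> R) k :
    1 < q -> (forall i, (i < k)%N -> u i = v i) -> u k + g <= v k ->
    (forall i, (k < i)%N -> u i - v i <= c * (q - 1)) ->
    radix_series q u @ \oo --> l -> radix_series q v @ \oo --> l' ->
  (g - c) / q ^+ k.+1 <= l' - l.
Proof.
move=> q1 uv gap uvc ul vl; have q0 : 0 < q by apply: lt_trans q1.
have wl := radix_seriesB_cvg ul vl.
have := radix_lim_le q1 uvc wl.
rewrite radix_series_head; last by move=> i /uv ->; rewrite subrr.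
rewrite -mulrDl => h; rewrite -[l' - l]opprB lerNr; apply: le_trans h _.
by rewrite -mulNr ler_wpM2r ?invr_ge0 ?exprn_ge0 ?(ltW q0) //; lra.
Qed.

(** The borderline case [g = c] of [radix_gap]: the inequality stays strict if
    one later digit falls short of the extreme difference. *)
Lemma radix_lt (R : realType) (q c l l' : R) (u v : nat -> R) k :
    1 < q -> (forall i, (i < k)%N -> u i = v i) -> u k + c <= v k ->
    (forall i, (k < i)%N -> u i - v i <= c * (q - 1)) ->
    (exists2 j, (k < j)%N & u j - v j < c * (q - 1)) ->
    radix_series q u @ \oo --> l -> radix_series q v @ \oo --> l' ->
  l < l'.
Proof.
move=> q1 uv gap uvc [j kj strict] ul vl.
have q0 : 0 < q by apply: lt_trans q1.
have wl := radix_seriesB_cvg ul vl.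
have uvcj i : (j.+1 <= i)%N -> u i - v i <= c * (q - 1).
  by move=> ji; apply: uvc; apply: ltn_trans ji.
rewrite -subr_lt0; apply: le_lt_trans (radix_lim_le q1 uvcj wl) _.
(* The digit at [j] makes the envelope drop strictly, from a value that is
   nonpositive right after position [k]. *)
rewrite radix_envelope_step //.
apply: (@lt_le_trans _ _ (radix_series q (fun i => u i - v i) j + c / q ^+ j)).
  by rewrite gtrBl divr_gt0 ?exprn_gt0 // subr_gt0.
apply: le_trans (radix_envelope_le q0 uvc kj) _.
rewrite radix_series_head; last by move=> i /uv ->; rewrite subrr.
rewrite -mulrDl mulr_le0_ge0 ?invr_ge0 ?exprn_ge0 ?(ltW q0) //; lra.
Qed.

(** * Binary expansions by the doubling map *)

Definition doubling (R : realType) (x : R) : R :=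
  if 2^-1 <= x then 2 * x - 1 else 2 * x.

Definition bit (R : realType) (t : R) (i : nat) : bool :=
  2^-1 <= iter i (@doubling R) t.

Lemma iter_doubling_itv (R : realType) (t : R) m :
  0 <= t <= 1 -> 0 <= iter m (@doubling R) t <= 1.
Proof.
move=> t01; elim: m => [//|m]; rewrite iterS /doubling.
by case: ifPn; rewrite -?ltNge; lra.
Qed.

(** The doubling map shifts the binary expansion: its [m]-th iterate is what
    remains after [m] bits, scaled back to [[0, 1]]. *)
Lemma bit_remainder (R : realType) (t : R) m :
  t = radix_series 2 (fun i => (bit t i)%:R) m + iter m (@doubling R) t / 2 ^+ m.
Proof.
elim: m => [|m IHm].
  by rewrite /radix_series /series /= big_nil expr0 divr1 add0r.
rewrite [LHS]IHm radix_seriesS iterS /doubling -/(@doubling R) /bit exprS.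
have m2 : (2 : R) ^+ m != 0 by rewrite expf_neq0 ?pnatr_eq0.
by case: ifPn => _ /=; field.
Qed.

Lemma bit_cvg (R : realType) (t : R) : 0 <= t <= 1 ->
  radix_series 2 (fun i => (bit t i)%:R) @ \oo --> t.
Proof.
move=> t01; apply/subr_cvg0; apply/norm_cvg0P.
apply: (@squeeze_cvgr _ _ _ _ (fun=> 0) (fun m => 1 / 2 ^+ m)); last 2 first.
- exact: cvg_cst.
- by apply: cvg_div_expr; rewrite ltr1n.
near=> m; rewrite normr_ge0 /= distrC {1}(bit_remainder t m) addrC addKr.
have := iter_doubling_itv m t01 => /andP[x0 x1].
by rewrite ger0_norm ?divr_ge0 ?exprn_ge0 // ler_pM2r ?invr_gt0 ?exprn_gt0.
Unshelve. all: by end_near. Qed.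

Lemma binary_prefix_rational (R : realType) (d : nat -> bool) m :
  exists r : rat, radix_series (2 : R) (fun i => (d i)%:R) m = ratr r.
Proof.
elim: m => [|m [r rE]].
  by exists 0; rewrite /radix_series /series /= big_nil rmorph0.
exists (r + (d m)%:R / 2 ^+ m.+1).
by rewrite radix_seriesS rE rmorphD fmorph_div rmorphXn /= !ratr_nat.
Qed.

(** If the bits are constant after position [k], the tail contributes 0 or a
    full [2 ^- k.+1] to a rational prefix. *)
Lemma irrational_bit_recurs (R : realType) (t : R) (b : bool) k :
    0 <= t <= 1 -> ~ range ratr t ->
  exists2 j, (k < j)%N & bit t j = b.
Proof.
move=> t01 tirr; apply: contrapT => nex.
have bk i : (k.+1 <= i)%N -> bit t i = ~~ b.
  move=> ki; have : bit t i <> b by move=> h; apply: nex; exists i.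
  by case: (bit t i); case: (b).
have [r rE] := binary_prefix_rational R (bit t) k.+1.
have := bit_remainder t k.+1; have := iter_doubling_itv k.+1 t01.
rewrite rE; set x := iter _ _ _ => /andP[x0 x1] tE.
apply: tirr; case: b bk {nex} => /= bk.
- exists r => //; apply/le_anti/andP; split.
    by rewrite tE lerDl divr_ge0 ?exprn_ge0.
  rewrite -[leRHS]addr0 -(mul0r ((2 ^+ k.+1)^-1)) -rE.
  apply: radix_lim_le (bit_cvg t01); first by rewrite ltr1n.
  by move=> i /bk ->; rewrite mul0r.
- exists (r + 1 / 2 ^+ k.+1) => //.
  rewrite rmorphD fmorph_div rmorphXn /= ratr_nat rmorph1.
  (* For the lower bound, bound the opposite series from above. *)
  have nt : radix_series 2 (fun i => -1 * (bit t i)%:R) @ \oo --> -1 * t.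
    rewrite (_ : radix_series _ _ =
        fun m => -1 * radix_series 2 (fun i => (bit t i)%:R) m).
      by apply: cvgMl_tmp; exact: bit_cvg.
    by apply/funext => m; rewrite radix_seriesZ.
  have := @radix_lim_le R 2 (-1) _ _ k.+1 _ _ nt.
  rewrite radix_seriesZ rE => h; apply/le_anti/andP; split.
    have := h _ _; rewrite ltr1n => /(_ isT).
    have bk1 i : (k < i)%N -> -1 * (bit t i)%:R <= -1 * (2 - 1) :> R.
      by move=> /bk -> /=; lra.
    move=> /(_ bk1); set w := (_ ^+ _)^-1 => hw; rewrite mul1r; lra.
  by rewrite tE lerD2l ler_pM2r ?invr_gt0 ?exprn_gt0.
Qed.

Lemma agreeing_bits_dist (R : realType) (t t' : R) k :
    0 <= t <= 1 -> 0 <= t' <= 1 ->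
    (forall i, (i < k)%N -> bit t i = bit t' i) ->
  `|t - t'| <= 2 ^- k.
Proof.
move=> t01 t'01 agree; rewrite (bit_remainder t k) (bit_remainder t' k).
have -> : radix_series (2 : R) (fun i => (bit t i)%:R) k
        = radix_series 2 (fun i => (bit t' i)%:R) k.
  by rewrite /radix_series /series /=; apply: eq_big_nat => i /andP[_ /agree ->].
rewrite opprD addrACA subrr add0r -mulrBl normrM.
rewrite [`|_^-1|]ger0_norm ?invr_ge0 ?exprn_ge0 //.
rewrite ler_piMl ?invr_ge0 ?exprn_ge0 //.
have := iter_doubling_itv k t01; have := iter_doubling_itv k t'01.
by rewrite ler_norml; lra.
Qed.

Lemma first_bit_change (R : realType) (t t' : R) :
    0 <= t <= 1 -> 0 <= t' <= 1 -> t != t' ->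
  exists2 k, bit t k != bit t' k & forall i, (i < k)%N -> bit t i = bit t' i.
Proof.
move=> t01 t'01 tt'; have ex : exists k, bit t k != bit t' k.
  apply: contrapT => nex; case/eqP: tt'.
  apply: (cvg_unique _ (bit_cvg t01)) => //.
  rewrite (_ : bit t = bit t'); first exact: bit_cvg.
  by apply/funext => i; apply/eqP/negP => ne; apply: nex; exists i; apply/negP.
exists (ex_minn ex) => [|i]; case: ex_minnP => // k _ kmin ik.
by apply/eqP; apply: contraTT ik => /kmin; rewrite -leqNgt.
Qed.

(** * A lower bound for the Hausdorff dimension *)

Lemma diameter_pow_ge0 (R : realType) (s : R) (E : set R) :
  (0 <= diameter_pow s E)%E.
Proof. by rewrite /diameter_pow; case: ifP => // _; exact: poweR_ge0. Qed.

Lemma dist_pow_le_diameter_pow (R : realType) (s : R) (E : set R) (x y : R) :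
  0 <= s -> E x -> E y -> ((`|x - y| `^ s)%:E <= diameter_pow s E)%E.
Proof.
move=> s0 Ex Ey; rewrite /diameter_pow ifF; last first.
  by apply/negbTE/set0P; exists x.
have xyE : (`|x - y|%:E <= diameter E)%E.
  by apply: ereal_sup_ubound; exists x => //; exists y.
rewrite -poweR_EFin; apply: gt0_ler_poweR => //; rewrite in_itv /= ?leey ?andbT //.
by apply: le_trans xyE; rewrite lee_fin.
Qed.

(** Lebesgue measure on [T] acts as a mass distribution: the part of [T] sent
    into a set of diameter [r] lies in an interval of radius [C * r ^ s0], so
    covering [E] cheaply would cover [T] by intervals of total length below
    its measure. *)
Lemma hausdorff_dim_ge_holder (R : realType) (E T : set R) (g : R -> R)
    (C s0 : R) :
    0 < C -> 0 < s0 -> measurable T -> (0 < lebesgue_measure T)%E ->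
    (forall t, T t -> E (g t)) ->
    (forall t t', T t -> T t' -> `|t - t'| <= C * `|g t - g t'| `^ s0) ->
  (s0%:E <= hausdorff_dim E)%E.
Proof.
move=> C0 s00 mT T0 gE gH; apply: le_ereal_inf_tmp => _ [s [s_ge0 Hs0] <-].
rewrite lee_fin leNgt; apply/negP => ss0.
have [e e0 eT] : exists2 e : R, 0 < e & (e%:E <= lebesgue_measure T)%E.
  case: (lebesgue_measure T) T0 => [r|_|//].
  - by rewrite lte_fin => r0; exists r.
  - by exists 1; rewrite ?ltr01 ?leey.
(* With mesh 1 all diameters are at most 1, and lowering the exponent from
   [s0] to [s] can only increase their powers. *)
have : (hausdorff_premeasure s 1 E < (e / (2 * C))%:E)%E.
  apply: (@le_lt_trans _ _ 0%E).
    by rewrite -Hs0; apply: ereal_sup_ubound; exists 1 => //=.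
  by rewrite lte_fin divr_gt0 // mulr_gt0.
case/ereal_inf_lt => _ [V [EV V1] <-] Vlt.
(* Centring the interval at a point of the covered part avoids infima and
   suprema; it costs the factor 2 in the bound above. *)
have ball i : exists cr : R * R, [/\ 0 <= cr.2,
    T `&` (g @^-1` V i) `<=` `[cr.1 - cr.2, cr.1 + cr.2]%classic &
    (cr.2%:E <= C%:E * diameter_pow s (V i))%E].
  case: (pselect (exists t, (T `&` (g @^-1` V i)) t)) => [[t0 [Tt0 Vt0]]|no].
  - case dE : (diameter_pow s (V i)) => [r| |].
    + exists (t0, C * r); split => /=.
      * by rewrite mulr_ge0 ?(ltW C0) // -lee_fin -dE diameter_pow_ge0.
      * move=> t [Tt Vt]; rewrite /= in_itv /= -ler_distl.
        apply: le_trans (gH _ _ Tt Tt0) _; rewrite ler_pM2l //.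
        have := @dist_pow_le_diameter_pow R s (V i) (g t) (g t0) s_ge0 Vt Vt0.
        rewrite dE lee_fin; apply: le_trans.
        have [->|gg0] := eqVneq `|g t - g t0| 0.
          by rewrite powR0 ?gt_eqF // powR_ge0.
        apply: ger_powR (ltW ss0); rewrite lt_def gg0 normr_ge0 /=.
        rewrite -lee_fin; apply: le_trans (V1 i).
        by apply: ereal_sup_ubound; exists (g t) => //; exists (g t0).
      * by rewrite EFinM.
    + have : (\sum_(0 <= i <oo) diameter_pow s (V i))%E = +oo%E.
        apply: (@nneseries_pinfty _ _ _ i) => // j _; exact: diameter_pow_ge0.
      by move=> ooE; move: Vlt; rewrite ooE ltNge leey.
    + by have := diameter_pow_ge0 s (V i); rewrite dE.
  - exists (0, 0); split => //=.
    + by move=> t Tt; case: no; exists t.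
    + by rewrite mule_ge0 ?diameter_pow_ge0 // lee_fin ltW.
have [cr crP] := choice ball.
pose I i : set R := `[(cr i).1 - (cr i).2, (cr i).1 + (cr i).2]%classic.
have mI i : measurable (I i) by exact: measurable_itv.
have TI : T `<=` \bigcup_i I i.
  move=> t Tt; case: (EV _ (gE _ Tt)) => i _ Vi; exists i => //.
  by case: (crP i) => _ + _; apply.
have II i : (lebesgue_measure (I i) <= (2 * C)%:E * diameter_pow s (V i))%E.
  have [r0 _ rle] := crP i.
  apply: (@le_trans _ _ (2%:E * (cr i).2%:E)%E); last first.
    by rewrite EFinM -muleA lee_pmul2l.
  rewrite /I lebesgue_measure_itv /=; case: ifP => _; rewrite ?lee_fin ?mulr_ge0 //.
  by lra.
suff : (lebesgue_measure T < e%:E)%E by rewrite ltNge eT.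
apply: le_lt_trans (measure_sigma_subadditive lebesgue_measure mI mT TI) _.
apply: (@le_lt_trans _ _
    (\sum_(0 <= i <oo) ((2 * C)%:E * diameter_pow s (V i)))%E).
  by apply: lee_nneseries => i _ *; [exact: measure_ge0|exact: II].
rewrite nneseriesZl; last by move=> i _; exact: diameter_pow_ge0.
rewrite muleC -lte_pdivlMr ?mulr_gt0 //.
Qed.

Lemma measurable_range_ratr (R : realType) : measurable (range ratr : set R).
Proof.
apply: countable_measurable => [t|]; first exact: measurable_set1.
by apply: sub_countable (card_image_le _ _) _; exact: countableP.
Qed.

Lemma irrational_itv_measure_gt0 (R : realType) :
  (0 < lebesgue_measure (`[0%R, 1%R]%classic `\` range ratr : set R))%E.
Proof.
have mQ := @measurable_range_ratr R.
have m01 : measurable (`[0, 1]%classic : set R) by exact: measurable_itv.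
have mT := measurableD m01 mQ.
rewrite -(@measureU0 _ _ _ lebesgue_measure _ _ mT mQ (lebesgue_measure_rat R)).
apply: (@lt_le_trans _ _ (lebesgue_measure (`[0%R, 1%R]%classic : set R))).
  by rewrite lebesgue_measure_itv /= lte01 -EFinB subr0 lte01.
apply: le_measure; rewrite ?inE //; first exact: measurableU.
by move=> t t01; have [|] := pselect (range ratr t); [right|left].
Qed.

(** * The Cantor set with extreme digits *)

Definition cantor_point (R : realType) (n : nat) (t : R) : R :=
  limn (radix_series n%:R (fun i => (n%:R - 1) * (bit t i)%:R)).

Lemma cantor_point_cvg (R : realType) (n : nat) (t : R) : (2 <= n)%N ->
  radix_series n%:R (fun i => (n%:R - 1) * (bit t i)%:R) @ \oo
    --> cantor_point n t.
Proof.
move=> n2; have n1 : (1 : R) < n%:R by rewrite ltr1n.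
apply: (@radix_series_cvg R n%:R (n%:R - 1)) => // i.
by case: (bit t i); rewrite ?mulr1 ?mulr0 lexx ?andbT subr_ge0 ltW.
Qed.

Arguments cantor_point_cvg {R n} t.

Lemma cantor_point_gap (R : realType) (n : nat) (t t' : R) k : (3 <= n)%N ->
    (forall i, (i < k)%N -> bit t i = bit t' i) -> bit t k != bit t' k ->
  n%:R ^- k.+1 <= `|cantor_point n t - cantor_point n t'|.
Proof.
move=> n3; have n2 : (2 <= n)%N by exact: ltnW.
have n3R : (3 : R) <= n%:R by rewrite ler_nat.
wlog bt : t t' / bit t k = false.
  move=> wlg agree ne; case bt: (bit t k); last exact: wlg.
  rewrite distrC; apply: wlg; last by rewrite eq_sym.
    by move: ne; rewrite bt; case: (bit t' k).
  by move=> i /agree.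
move=> agree; rewrite bt => bt'.
(* The later digits lose at most [n - 1] each, that is, 1 unit at position [k]
   against a gap of [n - 1], and [n - 2 >= 1]. *)
have gap := @radix_gap R n%:R (n%:R - 1) 1 _ _ _ _ k _ _ _ _
  (cantor_point_cvg t n2) (cantor_point_cvg t' n2).
rewrite distrC; apply: le_trans (ler_norm _); apply: le_trans (gap _ _ _ _).
- by rewrite ler_peMl ?invr_ge0 ?exprn_ge0 //; lra.
- by lra.
- by move=> i /agree ->.
- by rewrite bt; case: (bit t' k) bt' => //= _; rewrite mulr0 mulr1 add0r.
- by move=> i _; case: (bit t i); case: (bit t' i) => /=; lra.
Qed.

Lemma powR_ln2_ln (R : realType) (n : nat) : (2 <= n)%N ->
  (n%:R : R) `^ (ln 2 / ln n%:R) = 2.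
Proof.
move=> n2; have n0 : (0 : R) < n%:R by rewrite ltr0n; lia.
have ln0 : ln (n%:R : R) != 0 by rewrite gt_eqF // ln_gt0 // ltr1n.
by rewrite /powR gt_eqF // divfK // lnK // posrE.
Qed.

Arguments powR_ln2_ln R {n}.

(** With [k] the first different bit, [t] and [t'] are within [2 ^- k] and their
    images at least [n ^- k.+1] apart; the exponent turns [n] into 2, and the
    shift from [k] to [k.+1] is the factor 2. *)
Lemma cantor_point_holder (R : realType) (n : nat) (t t' : R) : (3 <= n)%N ->
    0 <= t <= 1 -> 0 <= t' <= 1 ->
  `|t - t'| <= 2 * `|cantor_point n t - cantor_point n t'| `^ (ln 2 / ln n%:R).
Proof.
move=> n3 t01 t'01; have [->|tt'] := eqVneq t t'.
  by rewrite subrr normr0 mulr_ge0 ?powR_ge0.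
have n2 : (2 <= n)%N by exact: ltnW.
have [k ne agree] := first_bit_change t01 t'01 tt'.
apply: le_trans (agreeing_bits_dist t01 t'01 agree) _.
have := powR_ln2_ln R n2; set s := ln 2 / ln n%:R => ns2.
have s0 : 0 <= s by rewrite divr_ge0 // ln_ge0 // ler1n; lia.
have := ge0_ler_powR s0 _ _ (cantor_point_gap n3 agree ne).
rewrite !nnegrE normr_ge0 invr_ge0 exprn_ge0 // => /(_ isT isT).
rewrite -(powR_invn _ (ler0n _ _)) -powRrM [_ * s]mulrC powRrM ns2.
rewrite powR_invn // => h.
apply: le_trans (_ : 2 * 2 ^- k.+1 <= _); last by rewrite ler_pM2l.
by rewrite exprS invfM mulrA divff ?mul1r // pnatr_eq0.
Qed.

(** * Uniqueness of extreme expansions *)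

(** At the first position where the digit sum differs from the extreme one,
    it differs by at least 2, since 1 and [2n - 3] are not sums of two digits.
    The later positions can compensate 2 units only if they all have the
    largest difference [2 (n - 1)], towards the other side; this forces every
    later extreme digit to be opposite to the one at the first difference,
    whereas [d] takes both values infinitely often. *)
Lemma extreme_digits_unique (R : realType) (n : nat) (A : set int)
    (d : nat -> bool) (a b : nat -> int) (x y z : R) :
    (3 <= n)%N -> A `<=` [set e : int | 0 <= e <= n%:Z - 1] ->
    ~ A 1 -> ~ A (n%:Z - 2) ->
    (forall c k, exists2 j, (k < j)%N & d j = c) ->
    (forall i, A (a i)) -> (forall i, A (b i)) ->
    radix_series n%:R (fun i => (a i)%:~R) @ \oo --> x ->
    radix_series n%:R (fun i => (b i)%:~R) @ \oo --> y ->
    radix_series n%:R (fun i => 2 * ((n%:R - 1) * (d i)%:R)) @ \oo --> z ->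
    z = x + y ->
  forall i, a i = (n%:Z - 1) * (d i)%:Z /\ b i = (n%:Z - 1) * (d i)%:Z.
Proof.
move=> n3 A01 A1 An2 drec Aa Ab ax yb dz zE.
pose ok i := (a i == (n%:Z - 1) * (d i)%:Z) && (b i == (n%:Z - 1) * (d i)%:Z).
suff allok j : ok j by move=> i; case/andP: (allok i) => /eqP -> /eqP ->.
apply: contrapT => noti.
have ex : exists i, ~~ ok i by exists j; apply/negP.
case: (ex_minnP ex) => k kbad kmin.
have digit c : A c -> 0 <= c <= n%:Z - 1 /\ c <> 1 /\ c <> n%:Z - 2.
  by move=> Ac; split; [exact: A01|split=> cE; [apply: A1|apply: An2]; rewrite -cE].
pose u i : R := (a i)%:~R + (b i)%:~R.
pose v i : R := 2 * ((n%:R - 1) * (d i)%:R).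
have ul : radix_series n%:R u @ \oo --> z.
  rewrite zE (_ : radix_series _ _ = radix_series n%:R (fun i => (a i)%:~R)
    \+ radix_series n%:R (fun i => (b i)%:~R)); first exact: cvgD.
  by apply/funext => m; rewrite radix_seriesD.
have uE i : u i = (a i + b i)%:~R by rewrite intrD.
have vE i : v i = (2 * ((n%:Z - 1) * (d i)%:Z))%:~R.
  by rewrite !intrM intrB -!pmulrn.
have bE : (2 * (n%:R - 1) : R) = (2 * (n%:Z - 1))%:~R.
  by rewrite intrM intrB -!pmulrn.
have uv i : (i < k)%N -> u i = v i.
  rewrite uE vE => ik; have : ok i.
    by apply: contraTT ik => /kmin; rewrite -leqNgt.
  by case/andP=> /eqP -> /eqP ->; congr _%:~R; ring.
have n1 : (1 : R) < n%:R by rewrite ltr1n; lia.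
have dig i := conj (digit _ (Aa i)) (digit _ (Ab i)).
move: kbad; rewrite /ok; case dk : (d k) => kbad.
- suff : z < z by rewrite ltxx.
  apply: (@radix_lt R n%:R 2 z z u v k) => //.
  + by rewrite uE vE -(intrD _ _ 2) ler_int dk; move: kbad; have := dig k; lia.
  + by move=> i _; rewrite uE vE bE -intrB ler_int; have := dig i; case: (d i); lia.
  + case: (drec true k) => m km dm; exists m => //.
    by rewrite uE vE bE -intrB ltr_int dm; have := dig m; lia.
- suff : z < z by rewrite ltxx.
  apply: (@radix_lt R n%:R 2 z z v u k) => //.
  + by move=> i /uv.
  + by rewrite uE vE -(intrD _ _ 2) ler_int dk; move: kbad; have := dig k; lia.
  + by move=> i _; rewrite uE vE bE -intrB ler_int; have := dig i; case: (d i); lia.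
  + case: (drec false k) => m km dm; exists m => //.
    by rewrite uE vE bE -intrB ltr_int dm; have := dig m; lia.
Qed.

Lemma double_cantor_point_unique (R : realType) (n : nat) (A : set int) (t : R) :
    (3 <= n)%N -> A 0 -> A (n%:Z - 1) ->
    A `<=` [set a : int | 0 <= a <= n%:Z - 1] ->
    ~ A 1 -> ~ A (n%:Z - 2) -> 0 <= t <= 1 -> ~ range ratr t ->
  uniqueness_set R n A (2 * cantor_point n t).
Proof.
move=> n3 A0 An1 A01 A1 An2 t01 tirr; have n2 : (2 <= n)%N by exact: ltnW.
have xl := cantor_point_cvg t n2; set x := cantor_point n t in xl *.
have digE (i : nat) : ((n%:Z - 1) * (bit t i)%:Z)%:~R
    = (n%:R - 1) * (bit t i)%:R :> R by rewrite intrM intrB -!pmulrn.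
have xC : C_set R n A x.
  exists (fun i => (n%:Z - 1) * (bit t i)%:Z); split.
    by move=> i; case: (bit t i); rewrite ?mulr1 ?mulr0.
  rewrite (_ : (fun i => _) = fun i => (n%:R - 1) * (bit t i)%:R / n%:R ^+ i.+1) //.
  by apply/funext => i; rewrite digE.
have zE : 2 * x = x + x by rewrite mulrDl mul1r.
split; first by exists x => //; exists x.
exists (x, x); split => [//|[y y'] /= [[a [Aa ya]] [b [Ab yb]] zyy']].
have zl : radix_series n%:R (fun i => 2 * ((n%:R - 1) * (bit t i)%:R)) @ \oo
    --> 2 * x.
  rewrite (_ : radix_series _ _ = fun m =>
    2 * radix_series n%:R (fun i => (n%:R - 1) * (bit t i)%:R) m).
    exact: cvgMl_tmp.
  by apply/funext => m; rewrite radix_seriesZ.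
have ab := extreme_digits_unique n3 A01 A1 An2
  (fun c k => irrational_bit_recurs c k t01 tirr) Aa Ab ya yb zl zyy'.
congr pair; apply: (cvg_unique _ xl) => //.
- apply: cvg_trans ya; rewrite /radix_series (_ : (fun i => (a i)%:~R / _) =
    fun i => (n%:R - 1) * (bit t i)%:R / n%:R ^+ i.+1) //.
  by apply/funext => i; rewrite (ab i).1 digE.
- apply: cvg_trans yb; rewrite /radix_series (_ : (fun i => (b i)%:~R / _) =
    fun i => (n%:R - 1) * (bit t i)%:R / n%:R ^+ i.+1) //.
  by apply/funext => i; rewrite (ab i).2 digE.
Qed.

Theorem corollary3p3 (R : realType) (n : nat) (A : set int)
  (n_ge2 : (2 <= n)%N) (A_good : n_good R n A)
  (A_no1 : ~ A 1) (A_no_n2 : ~ A (n%:Z - 2)) :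
  ((ln 2 / ln n%:R)%:E <= hausdorff_dim (uniqueness_set R n A))%E
  /\ 0 < ln 2 / ln n%:R :> R.
Proof.
have s0 : 0 < ln 2 / ln n%:R :> R by rewrite divr_gt0 // ln_gt0 // ltr1n.
split=> //; case: A_good => A0 An1 A01 _.
(* For [n = 2] the digit [n - 1] would be the excluded digit 1. *)
have n3 : (3 <= n)%N.
  by rewrite ltn_neqAle n_ge2 andbT; apply/eqP => n2; case: A_no1; rewrite -n2 in An1.
apply: (@hausdorff_dim_ge_holder R _ (`[0, 1]%classic `\` range ratr)
  (fun t => 2 * cantor_point n t) 2) => //.
- by apply: measurableD; [exact: measurable_itv|exact: measurable_range_ratr].
- exact: irrational_itv_measure_gt0.
- by move=> t [/= t01 tirr]; apply: double_cantor_point_unique.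
- move=> t t' [/= t01 _] [/= t'01 _].
  apply: le_trans (cantor_point_holder n3 t01 t'01) _; rewrite ler_pM2l //.
  apply: (ge0_ler_powR (ltW s0)); rewrite ?nnegrE //.
  by rewrite /= -mulrBr normrM ger0_norm // ler_peMl // ler1n.
Qed.
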